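(* Let $n\ge 1$ and let $P=([n],\prec)$ be a natural unit interval order which avoids the pattern $\mathbf{2}+\mathbf{1}+\mathbf{1}$. Let $G$ be the incomparability graph of $P$. Then $\omega(X_G)$ is $h$-positive, i.e. $\omega(X_G)$ is a linear combination of the complete homogeneous symmetric functions $h_\mu$ with nonnegative coefficients.
   Context: A natural unit interval order is a partial order $\prec$ on $[n]=\{1,\dots,n\}$ such that the usual order $<$ is a linear extension of $\prec$, and such that for any $a,b,c\in[n]$ with $b\prec c$ and $a$ incomparable to both $b$ and $c$, one has $b<a<c$. The poset avoids $\mathbf{2}+\mathbf{1}+\mathbf{1}$ if there are no four distinct elements $a,b,c,d$ with $a\prec b$, and with $c$ and $d$ incomparable to each other and each incomparable to both $a$ and $b$. The incomparability graph $G$ has vertex set $[n]$, with an edge between two vertices iff they are incomparable in $P$. For a finite graph $G$ with vertices $v_1,\dots,v_n$, the chromatic symmetric function is $X_G=\sum_\kappa x_{\kappa(v_1)}\cdots x_{\kappa(v_n)}$, summed over all proper colorings $\kappa:V(G)\to\{1,2,3,\dots\}$ (adjacent vertices get different colors). $\omega$ is the standard involution on the ring of symmetric functions with $\omega(e_\lambda)=h_\lambda$. *)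

(* Defs.v *)
From HB Require Import structures.
From mathcomp Require Import all_boot all_order all_algebra finmap.
From mathcomp Require Import boolp classical_sets fsbigop.
From mathcomp Require Import monalg.
From mathcomp Require mpoly.

Set Implicit Arguments.
Unset Strict Implicit.
Unset Printing Implicit Defensive.

Import Order.TTheory GRing.Theory Num.Theory.
Local Open Scope ring_scope.

(** [n] = {1, .., n} is represented by 'I_n = {0, .., n-1}. *)

Definition incomparable (T : eqType) (prec : rel T) : rel T :=
  fun a b => [&& a != b, ~~ prec a b & ~~ prec b a].

Record natural_unit_interval_order (n : nat) (prec : rel 'I_n) : Prop := {
  nuio_irr : irreflexive prec;
  nuio_trans : transitive prec;
  nuio_linext : forall a b : 'I_n, prec a b -> (a < b)%N;
  nuio_between : forall a b c : 'I_n, prec b c ->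
    incomparable prec a b -> incomparable prec a c -> (b < a)%N && (a < c)%N
}.

Definition avoids_2_1_1 (n : nat) (prec : rel 'I_n) : Prop :=
  ~ exists a b c d : 'I_n,
      [/\ uniq [:: a; b; c; d], prec a b, incomparable prec c d,
          incomparable prec c a && incomparable prec c b
        & incomparable prec d a && incomparable prec d b].

(** A power series over the integers in x_0, x_1, .. is given by its
    coefficients: [f m] is the coefficient of the monomial [m]. *)
Definition pseries := {cmonom nat} -> int.

Definition psone : pseries := fun m => (m == mone)%:R.

(** The set of factorisations [m = p.1 * p.2] is finite, so this [fsbig] sum
    never takes its default value. *)
Definition psmul (f g : pseries) : pseries := fun m =>
  \sum_(p \in [set p : {cmonom nat} * {cmonom nat} | mmul p.1 p.2 = m]%classic)
     f p.1 * g p.2.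

Definition proper_coloring (V : finType) (e : rel V) (k : V -> nat) : Prop :=
  forall u v : V, e u v -> k u != k v.

(** The sum over all proper colorings [k] of the monomials prod_v x_(k v),
    taken coefficientwise: only colorings with values in the support of [m]
    contribute to the coefficient of [m], so each of these sums is finite. The colors are 0, 1, 2, .. *)
Definition chromatic_symf (V : finType) (e : rel V) : pseries := fun m =>
  \sum_(k \in [set k : {ffun V -> nat} | proper_coloring e k]%classic)
     ((m == \big[mmul/mone]_(v : V) ucm (k v))%:R : int).

(** [esymf k] is the sum of all squarefree monomials of degree [k], and
    [hsymf k] the sum of all monomials of degree [k]. *)
Definition esymf (k : nat) : pseries := fun m =>
  ((mdeg m == k) && all (fun i => m i == 1%N) (finsupp m))%:R.

Definition hsymf (k : nat) : pseries := fun m => (mdeg m == k)%:R.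

Record intpart := IntPart {
  parts :> seq nat;
  _ : sorted geq parts && (0%N \notin parts)
}.
HB.instance Definition _ := [isSub for parts].
HB.instance Definition _ := [Choice of intpart by <:].

Definition partprod (b : nat -> pseries) (la : intpart) : pseries :=
  \big[psmul/psone]_(k <- parts la) b k.

Definition lincomb (b : intpart -> pseries)
    (c : {fsfun intpart -> int with 0}) : pseries :=
  fun m => \sum_(la <- finsupp c) c la * b la m.

(** The e_la form a basis of the ring of symmetric functions over the integers,
    hence a symmetric function [f] has exactly one expansion sum_la c_la e_la,
    and omega [f] = sum_la c_la h_la (see [omega_lincomb], [omega_e] below).
    Power series that are not symmetric functions have no such expansion and
    are sent to 0. *)
Definition omega (f : pseries) : pseries :=
  match pselect (exists c, f = lincomb (partprod esymf) c) with
  | left ex => lincomb (partprod hsymf) (projT1 (cid ex))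
  | right _ => fun=> 0
  end.

Definition h_positive (f : pseries) : Prop :=
  exists2 c : {fsfun intpart -> int with 0},
    f = lincomb (partprod hsymf) c & forall mu, 0 <= c mu.

(** Uniqueness of the e-expansion, by restriction to the variables
    x_0, .., x_(N-1) and the fundamental theorem of symmetric polynomials. *)
Module EExpansion.
Import mpoly.

Section Trunc.
Variable N : nat.
Implicit Types (m : multinom N).

Definition ev m (i : nat) : nat := oapp (fun j : 'I_N => m j) 0%N (insub i).

Definition emb m : {cmonom nat} :=
  mkcmonom [fsfun i in seq_fset tt (iota 0 N) => ev m i | 0%N].

Lemma embE m i : emb m i = ev m i.
Proof.
rewrite cmE fsfun_fun seq_fsetE mem_iota add0n leq0n /=.
by case: ltnP => // h; rewrite /ev insubF // ltnNge h.
Qed.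

Lemma embO m (i : 'I_N) : emb m i = m i.
Proof. by rewrite embE /ev valK. Qed.

Lemma embN m i : (N <= i)%N -> emb m i = 0%N.
Proof. by move=> h; rewrite embE /ev insubF // ltnNge h. Qed.

Lemma emb_inj : injective emb.
Proof. by move=> m1 m2 h; apply/mnmP => i; rewrite -!embO h. Qed.

Lemma emb_add m1 m2 : emb (mnm_add m1 m2) = mmul (emb m1) (emb m2).
Proof.
apply/eqP/cmP => i; rewrite cmM.
case: (ltnP i N) => h; last by rewrite !embN.
by rewrite -[i]/(val (Ordinal h)) !embO mnmDE.
Qed.

Lemma emb_deg m : monalg.mdeg (emb m) = mdeg m.
Proof.
rewrite (@monalg.mdegEw _ _ (seq_fset tt (iota 0 N))); last first.
  apply/fsubsetP => i; rewrite -monalg.cmE_neq0 seq_fsetE mem_iota /= add0n.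
  by apply: contraR; rewrite -leqNgt => h; rewrite embN.
rewrite mpoly.mdegE (perm_big (index_iota 0 N)); last first.
  apply: uniq_perm; [exact: (fset_uniq (seq_fset tt (iota 0 N)))|exact: iota_uniq|] => i.
  by rewrite seq_fsetE mem_index_iota mem_iota add0n.
by rewrite big_mkord; apply: eq_bigr => i _; rewrite embO.
Qed.

Definition res (a : {cmonom nat}) : multinom N := [multinom a i | i < N].

Lemma resK (a b : {cmonom nat}) m : mmul a b = emb m -> emb (res a) = a.
Proof.
move=> h; apply/eqP/cmP => i.
case: (ltnP i N) => hi; first by rewrite -[i]/(val (Ordinal hi)) embO mnmE.
rewrite embN //; have := cmM i a b; rewrite h embN // => /esym/eqP.
by rewrite addn_eq0 => /andP[/eqP ->].
Qed.

Definition agree (f : pseries) (p : (mpoly.mpoly N int)) : Prop :=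
  forall m, f (emb m) = p@_m.

Lemma agree1 : agree psone 1.
Proof.
move=> m; rewrite mcoeff1 /psone; congr (_%:R).
by rewrite -monalg.mdeg_eq0 emb_deg mpoly.mdeg_eq0.
Qed.

Lemma agreeM f g p q : agree f p -> agree g q -> agree (psmul f g) (p * q).
Proof.
move=> fp gq m; rewrite mcoeffM /psmul.
pose K := (bmultinom N (mdeg m).+1 * bmultinom N (mdeg m).+1)%type.
pose r := [seq (emb (bmnm k.1), emb (bmnm k.2)) | k : K <- enum
   [pred k : K | m == mnm_add (bmnm k.1) (bmnm k.2)]].
rewrite (fsbig_fwiden r).
- rewrite /r big_map big_enum /=; apply: eq_bigr => k _.
  by rewrite fp gq.
- case=> a b /= h; apply/mapP.
  have ha := resK h; have hb : emb (res b) = b.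
    by apply: (@resK b a m); rewrite -h mulmC.
  have dm : mdeg m = (mdeg (res a) + mdeg (res b))%N.
    by rewrite -!emb_deg ha hb -h monalg.mdegM.
  have la : (mdeg (res a) < (mdeg m).+1)%N by rewrite ltnS dm leq_addr.
  have lb : (mdeg (res b) < (mdeg m).+1)%N by rewrite ltnS dm leq_addl.
  exists (BMultinom la, BMultinom lb) => /=; last by rewrite ha hb.
  rewrite mem_enum inE /=; apply/eqP/emb_inj.
  by rewrite emb_add ha hb.
- rewrite map_inj_uniq ?enum_uniq // => -[a b] [c d] /= [].
  by move=> /emb_inj/val_inj -> /emb_inj/val_inj ->.
- move=> /= x [] /mapP[k]; rewrite mem_enum inE => /eqP mk -> /=.
  by case; rewrite -emb_add -mk.
Qed.

Lemma agree_esymf k : agree (esymf k) (mesym N int k).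
Proof.
move=> m; rewrite mcoeff_mesym /esymf /mechar emb_deg; congr ((_ && _)%:R).
apply/allP/forallP => [h i|h i hi].
  rewrite -embO; case: (boolP ((i : nat) \in finsupp (emb m))) => [/h/eqP -> //|].
  by rewrite -cmE_eq0 => /eqP ->.
move: hi; rewrite -cmE_neq0; case: (ltnP i N) => hi; last by rewrite embN.
by have := h (Ordinal hi); rewrite -[i]/(val (Ordinal hi)) embO; case: (m _) => [|[|]].
Qed.

Definition mult (la : intpart) : multinom N := [multinom count_mem (i.+1) (parts la) | i < N].

Let S : N.-tuple (mpoly.mpoly N int) := [tuple mesym N int i.+1 | i < N].

Lemma agree_part (la : intpart) : all (fun k => k <= N)%N (parts la) ->
  agree (partprod esymf la) (comp_mpoly S (mpolyX int (mult la))).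
Proof.
move=> hN.
have -> : comp_mpoly S (mpolyX int (mult la)) = \prod_(k <- parts la) mesym N int k.
  rewrite comp_mpolyX.
  rewrite -(big_undup_iterop_count _ (parts la) xpredT (mesym N int)) /=.
  transitivity (\prod_(k <- undup (parts la)) mesym N int k ^+ count_mem k (parts la)).
    have h0 : 0%N \notin parts la by case: (la) => s /= /andP[].
    rewrite (eq_bigr (fun i : 'I_N => mesym N int i.+1 ^+ count_mem i.+1 (parts la)));
      last by move=> i _; rewrite tnth_mktuple mnmE.
    transitivity (\prod_(1 <= i < N.+1) mesym N int i ^+ count_mem i (parts la)).
      by rewrite big_add1 big_mkord.
    rewrite (bigID (mem (parts la))) /= [X in _ * X]big1 ?mulr1; last first.
      by move=> i /count_memPn ->; rewrite expr0.
    rewrite -big_filter; apply: perm_big; apply: uniq_perm.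
    - by rewrite filter_uniq // iota_uniq.
    - exact: undup_uniq.
    - move=> k; rewrite mem_filter mem_undup mem_index_iota; case kla: (k \in _) => //=.
      rewrite ltnS (allP hN) // andbT lt0n; apply: contraNneq h0 => <-; exact: kla.
  apply: eq_bigr => k _.
  elim: (count_mem _ _) => [|[|n] IH] //=.
rewrite /partprod; elim: (parts la) => [|k s IH].
  by rewrite !big_nil; apply: agree1.
by rewrite !big_cons; apply: agreeM => //; apply: agree_esymf.
Qed.

Lemma agree_lincomb c (D : {fset intpart}) : finsupp c = D ->
  (forall la, la \in D -> all (fun k => k <= N)%N (parts la)) ->
  agree (lincomb (partprod esymf) c)
        (comp_mpoly S (\sum_(la <- D) c la *: mpolyX int (mult la))).
Proof.
move=> cD hD m; rewrite /lincomb cD (raddf_sum (comp_mpoly S)) (raddf_sum (mpoly.mcoeff m)) /=.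
rewrite !big_seq; apply: eq_bigr => la /hD/agree_part h.
by rewrite comp_mpolyZ mcoeffZ h.
Qed.

Lemma mult_inj (la mu : intpart) : all (fun k => k <= N)%N (parts la) ->
  all (fun k => k <= N)%N (parts mu) -> mult la = mult mu -> la = mu.
Proof.
case: la mu => [s hs] [t ht] /= sN tN e; apply: val_inj => /=.
have [ss s0] := andP hs; have [ts t0] := andP ht.
apply: (@sorted_eq _ geq); rewrite ?ss ?ts //.
- by move=> x y z /= h1 h2; apply: leq_trans h2 h1.
- by move=> x y; rewrite /= andbC => /anti_leq.
apply/allP => [[|k]] _ /=.
  by rewrite (count_memPn s0) (count_memPn t0).
case: (ltnP k N) => h.
  by have := congr1 (fun m : multinom N => m (Ordinal h)) e; rewrite !mnmE => ->.
have no u : all (fun k => k <= N)%N u -> k.+1 \notin u.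
  by move=> hu; apply/negP => /(allP hu); rewrite ltnNge h.
by rewrite (count_memPn (no _ sN)) (count_memPn (no _ tN)).
Qed.

End Trunc.

Lemma lincomb_esymf_inj : injective (lincomb (partprod esymf)).
Proof.
have key (c c' : {fsfun intpart -> int with 0}) mu :
  lincomb (partprod esymf) c = lincomb (partprod esymf) c' ->
  mu \in finsupp c -> c mu = c' mu.
  move=> e muc.
  pose D := (finsupp c `|` finsupp c')%fset.
  pose N := (\max_(la <- D) \max_(k <- parts la) k)%N.
  have DN la : la \in D -> all (fun k => k <= N)%N (parts la).
    move=> h; apply/allP => k hk.
    apply: (@leq_trans (\max_(k <- parts la) k)); first exact: (@leq_bigmax_seq _ (parts la) xpredT id k hk).
    exact: (@leq_bigmax_seq _ (enum_fset D) xpredT (fun la : intpart => \max_(k <- parts la) k)%N la h).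
  have P (d : {fsfun intpart -> int with 0}) : (finsupp d `<=` D)%fset -> (\sum_(la <- finsupp d) d la *: mpolyX int (mult N la))@_(mult N mu) = d mu.
    move=> dD; rewrite raddf_sum /=.
    have muD : mu \in D by rewrite inE muc.
    case: (boolP (mu \in finsupp d)) => h.
      rewrite (bigD1_seq mu) ?fset_uniq //= mcoeffZ mcoeffX eqxx mulr1 big_seq_cond big1 ?addr0 //.
      move=> la /andP[hla ne]; rewrite mcoeffZ mcoeffX; case: eqP => [/mult_inj E|]; rewrite ?mulr0 //.
      by rewrite E ?eqxx // in ne; apply: DN => //; apply: (fsubsetP dD).
    have dmu := fsfun_dflt h.
    rewrite big_seq big1 => [|la hla]; first by rewrite dmu.
    rewrite mcoeffZ mcoeffX.
    case: eqP => [/mult_inj E|]; rewrite ?mulr0 //.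
    by rewrite -E ?hla // in h; apply: DN => //; apply: (fsubsetP dD).
  rewrite -(P c) ?fsubsetUl // -(P c') ?fsubsetUr //; congr (_@__).
  apply: msym_fundamental_un; apply/mpolyP => m.
  rewrite -(@agree_lincomb N c _ erefl) ?e => [|la h]; last by apply: DN; rewrite inE h.
  by rewrite (@agree_lincomb N c' _ erefl) // => la h; apply: DN; rewrite inE h orbT.
move=> c c' e; apply/fsfunP => mu.
case: (boolP (mu \in finsupp c)) => h; first exact: key.
case: (boolP (mu \in finsupp c')) => h'; first by apply/esym; apply: key.
by rewrite (fsfun_dflt h) (fsfun_dflt h').
Qed.

End EExpansion.

Lemma omega_lincomb c :
  omega (lincomb (partprod esymf) c) = lincomb (partprod hsymf) c.
Proof.
rewrite /omega; case: pselect => [ex|[]]; last by exists c.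
by case: (cid ex) => c' /= /EExpansion.lincomb_esymf_inj ->.
Qed.

Lemma lincomb1 b (la : intpart) :
  lincomb b [fsfun [fsfun] with la |-> 1] = b la.
Proof.
apply: funext => m; rewrite /lincomb.
pose c : {fsfun intpart -> int with 0} := [fsfun [fsfun] with la |-> 1].
have cE mu : c mu = (mu == la)%:R.
  by rewrite fsfun_withE; case: eqP => // _; rewrite fsfunE.
have -> : finsupp c = [fset la]%fset.
  by apply/fsetP => mu; rewrite mem_finsupp cE inE; case: (mu == la).
by rewrite big_seq_fset1 cE eqxx mul1r.
Qed.

Lemma omega_e (la : intpart) : omega (partprod esymf la) = partprod hsymf la.
Proof. by rewrite -!lincomb1 omega_lincomb. Qed.

(* Main.v *)
(** The incomparability graph of a unit interval order avoiding 2+1+1 is an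
    indifference graph without diamonds: its components are chains of cliques,
    consecutive ones sharing a single vertex.  Such a graph is built by
    repeatedly gluing a clique at the last vertex, so one follows the vector
    [F_k], indexed by colors [k], of the weighted proper colorings giving color
    [k] to the last vertex.  Put [U_k(n) = x_k e_n(x without x_k)].  Gluing a
    clique with [b + 2] vertices replaces [F] by [b!] times the vector
    [x_k sum_(i <> k) F_i e_b(x without x_i, x_k)], and for [F = U(a)] the
    latter sum equals
      [(b+1) U_k(a+b+1) + sum_(c < min(a, b+1))
         ((b-c) U_k(a+b-c) e_(c+1) + (a-c) U_k(c) e_(a+b+1-c))].
    Hence nonnegative combinations of the vectors [U(n) e_la] are preserved;
    since [sum_k U_k(n) = (n+1) e_(n+1)], the chromatic symmetric function is
    e-positive, and omega turns its e-expansion into an h-expansion. *)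

Require Import Defs.
From mathcomp Require mpoly.
From mathcomp Require Import boolp classical_sets fsbigop monalg.
From mathcomp Require Import all_boot all_algebra finmap ring zify.
Set Implicit Arguments.
Unset Strict Implicit.
Unset Printing Implicit Defensive.
Import GRing.Theory Num.Theory.
Local Open Scope ring_scope.

(** * Elementary symmetric sums and clique gluing *)

Section ElementarySums.
Variables (R : comNzRingType) (C : finType) (x : C -> R).
Implicit Types (A B : {set C}) (c i k : C) (n a b p q : nat).

Definition elem A n : R :=
  \sum_(B : {set C} | (B \subset A) && (#|B| == n)) \prod_(i in B) x i.

Lemma elem0 A : elem A 0 = 1.
Proof.
rewrite /elem (big_pred1 set0) ?big_set0 // => B /=.
by rewrite cards_eq0; case: eqP => [->|]; rewrite ?sub0set ?andbF.
Qed.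

(** Adjoining [c] is a bijection from the [n]-subsets of [A :\ c] onto the [n.+1]-subsets of [A]
    that contain [c]. *)
Lemma elem_mem A c n : c \in A ->
  x c * elem (A :\ c) n =
  \sum_(B : {set C} | [&& B \subset A, #|B| == n.+1 & c \in B]) \prod_(i in B) x i.
Proof.
move=> cA; rewrite /elem mulr_sumr.
rewrite [RHS](reindex_onto (fun B => c |: B) (fun B => B :\ c)) /=; last first.
  by move=> B /and3P[_ _ cB]; rewrite setD1K.
apply: eq_big => [B|B /andP[]].
  rewrite subsetD1 setU11 andbT cardsU1 subUset sub1set cA /=.
  case: (boolP (c \in B)) => cB /=.
    rewrite andbF; apply/esym/negbTE/negP => /andP[_ /eqP h].
    by move: cB; rewrite -h setD11.
  by rewrite add1n eqSS setU1K // eqxx !andbT.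
by rewrite subsetD1 => /andP[_ cB] _; rewrite big_setU1.
Qed.

Lemma elemS A c n : c \in A ->
  elem A n.+1 = elem (A :\ c) n.+1 + x c * elem (A :\ c) n.
Proof.
move=> cA; rewrite elem_mem // {1}/elem (bigID (fun B => c \in B)) /= addrC.
congr (_ + _); apply: eq_bigl => B; last by rewrite -andbA.
by rewrite subsetD1 andbAC.
Qed.

(** Euler's identity by double counting: every [n.+1]-subset arises once for each of its
    elements. *)
Lemma sum_elem A n :
  \sum_(c in A) x c * elem (A :\ c) n = elem A n.+1 *+ n.+1.
Proof.
under eq_bigr => c cA do rewrite elem_mem //.
rewrite (exchange_big_dep (fun B : {set C} => (B \subset A) && (#|B| == n.+1))) /=;
  last by move=> c B _ /and3P[-> ->].
rewrite /elem -sumrMnl; apply: eq_bigr => B /andP[BA /eqP <-].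
rewrite -sumr_const; apply: eq_bigl => c; rewrite BA eqxx /=.
by case: (boolP (c \in B)) => cB; rewrite ?andbF // (subsetP BA).
Qed.

Definition esum n : R := elem setT n.
(** The vector U(n), which is x_k times the partial derivative of e_(n+1) in x_k. *)
Definition vsum k n : R := x k * elem [set~ k] n.

Lemma setTDE k : [set: C] :\ k = [set~ k].
Proof. by rewrite setTD. Qed.

Lemma sum_vsum n : \sum_k vsum k n = esum n.+1 *+ n.+1.
Proof.
rewrite -sum_elem; apply: eq_big => [k|k _]; first by rewrite inE.
by rewrite /vsum setTDE.
Qed.

Section Fixed.
Variable k : C.
Let y n := elem [set~ k] n.
Let z i n := elem ([set~ k] :\ i) n.
(** Splitting x_k off from U_i(a) turns the left side of the gluing identity into a combination of
    two such sums. *)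
Let Q p q := \sum_(i in [set~ k]) x i * z i p * z i q.

Let esumS n : esum n.+1 = y n.+1 + x k * y n.
Proof. by rewrite /esum (@elemS setT k) ?inE // setTDE. Qed.

Let yS i n : i \in [set~ k] -> y n.+1 = z i n.+1 + x i * z i n.
Proof. exact: elemS. Qed.

Let Q0 p : Q p 0 = y p.+1 *+ p.+1.
Proof. by rewrite -sum_elem; apply: eq_bigr => i _; rewrite /z elem0 mulr1. Qed.

Let QC p q : Q p q = Q q p.
Proof. by apply: eq_bigr => i _; rewrite mulrAC. Qed.

(* Both [Q p q.+1] and [Q p.+1 q], completed by the sum of
   [x_i ^ 2 z_p z_q], factor by Euler's identity [sum_elem]. *)
Let QS p q : Q p q.+1 + y p.+1 * y q.+1 *+ q.+1 =
             Q p.+1 q + y p.+1 * y q.+1 *+ p.+1.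
Proof.
have Qy a b : Q a b.+1 + \sum_(i in [set~ k]) x i ^+ 2 * z i a * z i b =
              y a.+1 * y b.+1 *+ a.+1.
  rewrite -mulrnAl -sum_elem mulr_suml -big_split /=.
  by apply: eq_bigr => i ik; rewrite (yS _ ik) /z; ring.
have SC : \sum_(i in [set~ k]) x i ^+ 2 * z i p * z i q =
          \sum_(i in [set~ k]) x i ^+ 2 * z i q * z i p.
  by apply: eq_bigr => i _; rewrite mulrAC.
by rewrite -Qy [_ * y q.+1]mulrC -Qy QC SC (QC p.+1); ring.
Qed.

(** Iterating [QS] lowers [q] to 0, where [Q0] applies; the step down from [t] to [t - 1] leaves the
    term of index [t]. *)
Let QE p q : Q p q =
  \sum_(t < q.+1) ((p + q).+1%:R - (t.*2)%:R) * (y t * y ((p + q).+1 - t)).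
Proof.
elim: q p => [|q IH] p.
  rewrite big_ord1 subn0 addn0 Q0 subr0 /y elem0 mul1r.
  by rewrite mulr_natl.
rewrite -[LHS](addrK (y p.+1 * y q.+1 *+ q.+1)) QS.
rewrite IH addSnnS.
rewrite [RHS]big_ord_recr /= -addrA; congr (_ + _).
have -> : ((p + q.+1).+1 - q.+1 = p.+1)%N by lia.
have -> : (q.+1.*2 = q.+1 + q.+1)%N by rewrite addnn.
have -> : ((p + q.+1).+1 = p.+1 + q.+1)%N by lia.
by rewrite !natrD; ring.
Qed.

(** Both sides are expanded in powers of x_k, with coefficients built from products of two values of
    [y]: the left side through [QE], the right side through [esumS]. *)
Lemma vsum_glue a b :
  x k * (\sum_(i in [set~ k]) vsum i a * elem ([set~ k] :\ i) b) =
  vsum k (a + b).+1 *+ b.+1 +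
  \sum_(c < minn a b.+1)
     (vsum k (a + b - c) * esum c.+1 *+ (b - c) +
      vsum k c * esum (a + b - c).+1 *+ (a - c)).
Proof.
case: a => [|a].
  rewrite min0n big_ord0 addr0 add0n /vsum -mulrnAr -sum_elem; congr (_ * _).
  by apply: eq_bigr => i ik; rewrite elem0 mulr1.
have -> : x k * (\sum_(i in [set~ k]) vsum i a.+1 * elem ([set~ k] :\ i) b) =
          x k * Q a.+1 b + x k ^+ 2 * Q a b.
  rewrite !mulr_sumr -big_split /=; apply: eq_bigr => i ik.
  rewrite /vsum (@elemS _ k) ?inE 1?eq_sym; last by move: ik; rewrite !inE.
  have -> : [set~ i] :\ k = [set~ k] :\ i by apply/setP => j; rewrite !inE andbC.
  by rewrite -/(z i _) -/(z i _) -/(z i _); ring.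
pose M := (a + b).+2.
(* Closed form of the partial sums of the right side; in degree one of x_k a boundary term at index
   [mu] survives the telescoping. *)
have E mu : (mu <= minn a.+1 b.+1)%N ->
  vsum k (a.+1 + b).+1 *+ b.+1 +
  \sum_(c < mu) (vsum k (a.+1 + b - c) * esum c.+1 *+ (b - c) +
      vsum k c * esum (a.+1 + b - c).+1 *+ (a.+1 - c)) =
  x k * (\sum_(t < mu) (M%:R - (t.*2)%:R) * (y t * y (M - t))
         + (b.+1%:R - mu%:R) * (y mu * y (M - mu))) +
  x k ^+ 2 * \sum_(t < mu) ((a + b).+1%:R - (t.*2)%:R) * (y t * y ((a + b).+1 - t)).
  elim: mu => [_|mu IH hmu].
    rewrite !big_ord0 /M subn0 /vsum -/(y _) addSn [y 0]elem0 -mulr_natr.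
    by ring.
  rewrite !big_ord_recr /= addrA IH; last exact: ltnW.
  rewrite /vsum -!/(y _) !esumS /M.
  have -> : ((a.+1 + b - mu).+1 = (a + b).+2 - mu)%N by lia.
  have -> : (a.+1 + b - mu = (a + b).+1 - mu)%N by lia.
  have -> : ((a + b).+2 - mu.+1 = (a + b).+1 - mu)%N by lia.
  rewrite !mulrnBr; try lia.
  have -> : (mu.*2 = mu + mu)%N by rewrite addnn.
  have -> : ((a + b).+2 = a.+1 + b.+1)%N by lia.
  have -> : ((a + b).+1 = a.+1 + b)%N by lia.
  by rewrite !natrD -!natr1 ?mulrSr; ring.
(* Over the full range the boundary term is the last term of [QE] for [Q b a.+1] if [a <= b];
   otherwise [mu = b.+1] and it vanishes. *)
rewrite (E _ (leqnn _)); congr (_ * _ + _ * _).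
  have [h|h] := leqP a.+1 b.+1.
    rewrite QC QE big_ord_recr /= !addnS [(b + a)%N]addnC; congr (_ + _).
    have -> : (a.+1.*2 = a.+1 + a.+1)%N by rewrite addnn.
    have -> : ((a + b).+2 = a.+1 + b.+1)%N by lia.
    rewrite !natrD /M; have -> : ((a + b).+2 = a.+1 + b.+1)%N by lia.
    by ring.
  by rewrite subrr mul0r addr0 QE.
have [h|h] := leqP a.+1 b.+1; last by rewrite QE.
by rewrite QC QE [(b + a)%N]addnC.
Qed.

End Fixed.
End ElementarySums.

(** * The cone of e-positive color vectors *)

(** Quantifying over all rings and color sets lets a single expansion serve every number of
    variables. *)
Definition color_sum : Type :=
  forall (R : comNzRingType) (C : finType), (C -> R) -> R.

Definition color_vector : Type :=
  forall (R : comNzRingType) (C : finType), (C -> R) -> C -> R.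

(** [L] is chosen before the ring and the variables. Repeated entries encode nonnegative integer
    coefficients, and the entries need not be partitions. *)
Definition epositive (G : color_sum) : Prop :=
  exists L : seq (seq nat), forall R C x,
    G R C x = \sum_(l <- L) \prod_(j <- l) esum x j.

Definition vpositive (F : color_vector) : Prop :=
  exists L : seq (nat * seq nat), forall R C x k,
    F R C x k = \sum_(p <- L) vsum x k p.1 * \prod_(j <- p.2) esum x j.

Lemma vpositive_ext (F G : color_vector) :
  (forall R C x k, F R C x k = G R C x k) -> vpositive G -> vpositive F.
Proof. by move=> FG [L hL]; exists L => R C x k; rewrite FG. Qed.

Lemma vpositive0 : vpositive (fun R C x k => 0).
Proof. by exists [::] => R C x k; rewrite big_nil. Qed.

Lemma vpositiveD (F G : color_vector) : vpositive F -> vpositive G ->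
  vpositive (fun R C x k => F R C x k + G R C x k).
Proof. by move=> [L hL] [M hM]; exists (L ++ M) => R C x k; rewrite big_cat hL hM. Qed.

Lemma vpositiveMn (F : color_vector) n : vpositive F ->
  vpositive (fun R C x k => F R C x k *+ n).
Proof.
move=> hF; elim: n => [|n IH]; first exact: vpositive0.
by apply: vpositive_ext (vpositiveD hF IH) => R C x k; rewrite mulrS.
Qed.

Lemma vpositive_sum (I : Type) (r : seq I) (F : I -> color_vector) :
  (forall i, vpositive (F i)) ->
  vpositive (fun R C x k => \sum_(i <- r) F i R C x k).
Proof.
move=> hF; elim: r => [|i r IH].
  by apply: vpositive_ext vpositive0 => R C x k; rewrite big_nil.
by apply: vpositive_ext (vpositiveD (hF i) IH) => R C x k; rewrite big_cons.
Qed.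

Lemma vpositiveM (F : color_vector) (G : color_sum) : vpositive F -> epositive G ->
  vpositive (fun R C x k => F R C x k * G R C x).
Proof.
move=> [L hL] [M hM]; exists [seq (p.1, p.2 ++ l) | p <- L, l <- M] => R C x k.
rewrite hL hM mulr_suml big_allpairs_dep /=; apply: eq_bigr => p _.
by rewrite mulr_sumr; apply: eq_bigr => l _; rewrite big_cat mulrA.
Qed.

Lemma vpositive_vsum n : vpositive (fun R C x k => vsum x k n).
Proof. by exists [:: (n, [::])] => R C x k; rewrite big_seq1 big_nil mulr1. Qed.

Lemma epositive_esum n : epositive (fun R C x => esum x n).
Proof. by exists [:: [:: n]] => R C x; rewrite !big_seq1. Qed.

Lemma epositive_prod (l : seq nat) : epositive (fun R C x => \prod_(j <- l) esum x j).
Proof. by exists [:: l] => R C x; rewrite big_seq1. Qed.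

Lemma vpositive_total (F : color_vector) : vpositive F ->
  epositive (fun R C x => \sum_k F R C x k).
Proof.
(* U(n) sums to (n+1) e_(n+1), hence the [p.1.+1] copies. *)
move=> [L hL]; exists (flatten [seq nseq p.1.+1 (p.1.+1 :: p.2) | p <- L]) => R C x.
under eq_bigr => k _ do rewrite hL.
rewrite exchange_big big_flatten big_map; apply: eq_bigr => p _.
by rewrite -mulr_suml sum_vsum big_nseq -Monoid.iteropE big_cons mulrnAl.
Qed.

Lemma vpositive_start (G : color_sum) : epositive G ->
  vpositive (fun R C x k => x k * G R C x).
Proof.
move=> hG; apply: vpositive_ext (vpositiveM (vpositive_vsum 0) hG) => R C x k.
by rewrite /vsum elem0 mulr1.
Qed.

(** Gluing is linear in [F], so it suffices to treat U(a) e_la, where every multiplicity in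
    [vsum_glue] is a natural number. *)
Lemma vpositive_glue (F : color_vector) b : vpositive F ->
  vpositive (fun R C x k =>
    x k * \sum_(i in [set~ k]) F R C x i * elem x ([set~ k] :\ i) b).
Proof.
move=> [L hL].
pose G (p : nat * seq nat) : color_vector := fun R C x k =>
  (vsum x k (p.1 + b).+1 *+ b.+1 + \sum_(c <- index_enum 'I_(minn p.1 b.+1))
     (vsum x k (p.1 + b - c) * esum x c.+1 *+ (b - c) +
      vsum x k c * esum x (p.1 + b - c).+1 *+ (p.1 - c)))
  * \prod_(j <- p.2) esum x j.
have hG p : vpositive (G p).
  apply: vpositiveM (epositive_prod _); apply: vpositiveD.
    exact/vpositiveMn/vpositive_vsum.
  by apply: vpositive_sum => c; apply: vpositiveD;
    apply: vpositiveMn; apply: vpositiveM (epositive_esum _); apply: vpositive_vsum.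
apply: vpositive_ext (vpositive_sum L hG) => R C x k.
rewrite /G; under [RHS]eq_bigr => p _ do rewrite -vsum_glue.
under [in LHS]eq_bigr => i _ do rewrite hL mulr_suml.
rewrite exchange_big mulr_sumr /=; apply: eq_bigr => p _.
rewrite -mulrA mulr_suml; congr (_ * _); apply: eq_bigr => i _.
by rewrite mulrAC.
Qed.

(** * Colorings as lists of colors *)

Section ListSums.
Variables (R : comNzRingType) (C : finType).
Implicit Types (phi psi : seq C -> R).

(** Nested sums allow the head or, by [lsum_cat], a whole block of vertices to be summed
    separately. *)
Fixpoint lsum n phi : R :=
  if n is m.+1 then \sum_k lsum m (fun w => phi (k :: w)) else phi [::].

Lemma lsumS n phi : lsum n.+1 phi = \sum_k lsum n (fun w => phi (k :: w)).
Proof. by []. Qed.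

Lemma eq_lsum n phi psi :
  (forall w, size w = n -> phi w = psi w) -> lsum n phi = lsum n psi.
Proof.
elim: n phi psi => [|n IH] phi psi h /=; first exact: h.
by apply: eq_bigr => k _; apply: IH => w sw; apply: h; rewrite /= sw.
Qed.

Lemma lsum_cat m n phi :
  lsum (m + n) phi = lsum m (fun v => lsum n (fun w => phi (v ++ w))).
Proof. by elim: m phi => [//|m IH] phi /=; apply: eq_bigr => k _; rewrite IH. Qed.

Lemma lsumMl n a phi : lsum n (fun w => a * phi w) = a * lsum n phi.
Proof.
elim: n phi => [//|n IH] phi /=; rewrite mulr_sumr.
by apply: eq_bigr => k _; rewrite IH.
Qed.

Lemma lsumMr n a phi : lsum n (fun w => phi w * a) = lsum n phi * a.
Proof.
by rewrite mulrC -lsumMl; apply: eq_lsum => w _; rewrite mulrC.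
Qed.

Lemma lsum_sum n (I : finType) (P : pred I) (phi : I -> seq C -> R) :
  lsum n (fun w => \sum_(i | P i) phi i w) = \sum_(i | P i) lsum n (phi i).
Proof.
elim: n phi => [//|n IH] phi /=; rewrite exchange_big /=.
by apply: eq_bigr => k _; rewrite IH.
Qed.

Lemma lsum_tuple n phi : lsum n phi = \sum_(t : n.-tuple C) phi t.
Proof.
elim: n phi => [|n IH] phi /=.
  by rewrite (big_pred1 [tuple]) // => t; apply/esym/eqP/tuple0.
under eq_bigr => k _ do rewrite IH.
rewrite pair_bigA /= (reindex (fun p : C * n.-tuple C => [tuple of p.1 :: p.2])) //=.
exists (fun t => (thead t, [tuple of behead t])) => [[k t] _|t _] /=.
  by congr (_, _); apply: val_inj.
by rewrite [RHS]tuple_eta.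
Qed.

Variable x : C -> R.

(** Once the head [c] is fixed, the tail has to avoid both [A] and [c]; each use of [sum_elem] then
    supplies one factor of the factorial. *)
Lemma lsum_uniq (A : {set C}) n :
  lsum n (fun v => (uniq v && all [predC A] v)%:R * \prod_(c <- v) x c) =
  elem x (~: A) n *+ n`!.
Proof.
elim: n A => [|n IH] A /=; first by rewrite big_nil elem0 mulr1.
rewrite factS mulrnA -sum_elem -sumrMnl [RHS]big_mkcond /=.
apply: eq_bigr => c _; rewrite inE; case: (boolP (c \in A)) => cA /=.
  rewrite -[RHS](mul0r (lsum n (fun=> 0))) -lsumMl; apply: eq_lsum => v _.
  by rewrite andbF !mul0r.
have -> : ~: A :\ c = ~: (c |: A) by apply/setP => d; rewrite !inE negb_or.
rewrite -mulrnAr -IH -lsumMl; apply: eq_lsum => v _.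
rewrite big_cons mulrCA; congr (_ * (_%:R * _)).
have -> : all [predC c |: A] v = (c \notin v) && all [predC A] v.
  elim: v => [//|d v IHv] /=; rewrite IHv !inE !negb_or [c == d]eq_sym.
  by rewrite -!andbA; congr (_ && _); rewrite andbCA.
by rewrite andbA [uniq v && _]andbC.
Qed.

(* Colorings are listed from the last vertex to the first, and vertex [j] is
   adjacent to exactly [d j] of its predecessors, namely the last ones. *)
Variable d : nat -> nat.

Fixpoint weight (w : seq C) : R :=
  if w is k :: w' then (k \notin take (d (size w')) w')%:R * x k * weight w'
  else 1.

Lemma weight_cons k w :
  weight (k :: w) = (k \notin take (d (size w)) w)%:R * x k * weight w.
Proof. by []. Qed.

(** The F_k of the overview, for the graph on the vertices 0 to [j]. *)
Definition last_color j k : R := lsum j (fun w => weight (k :: w)).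

Lemma last_color_isolated j k : d j = 0 -> last_color j k = x k * lsum j weight.
Proof.
move=> dj; rewrite -lsumMl; apply: eq_lsum => w sw /=.
by rewrite sw dj take0 mul1r.
Qed.

(** Each vertex of [v] sees exactly the earlier vertices of [v] and vertex [s], colored [i]. The
    conditions therefore say that [v] and [i] together have no repetition, whatever [w] is. *)
Lemma weight_clique s v i w : size w = s ->
  (forall t, s < t <= s + size v -> d t = t - s)%N ->
  weight (v ++ i :: w) =
  (uniq v && (i \notin v))%:R * \prod_(c <- v) x c * weight (i :: w).
Proof.
move=> sw; elim: v => [|c v IH] hd; first by rewrite big_nil !mul1r.
rewrite cat_cons weight_cons size_cat [size (i :: w)]/= sw hd; last first.
  by rewrite addnS [size (_ :: _)]/=; lia.
have -> : (size v + s.+1 - s = size v + 1)%N by lia.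
rewrite takeD take_size_cat // drop_size_cat // take_cons take0 mem_cat mem_seq1.
rewrite IH; last by move=> t ht; apply: hd; rewrite [size (_ :: _)]/=; lia.
rewrite big_cons [uniq (c :: v)]/= inE !negb_or [i == c]eq_sym.
move: (weight _) => W.
case: (c \in v) => /=; first by rewrite !mul0r.
case: (c == i) => /=; first by rewrite andbF !mul0r.
by rewrite !mul1r !mulrA [x c * _]mulrC.
Qed.

(** The vertices [s] to [b + s.+1] form a clique. With the end colors [i] and [k] fixed, the [b]
    inner vertices take distinct other colors, and [lsum_uniq] sums over these. *)
Lemma last_color_clique s b k :
  (forall t, s < t <= (s + b).+1 -> d t = t - s)%N ->
  last_color (b + s.+1) k =
  x k * \sum_(i in [set~ k]) last_color s i * elem x ([set~ k] :\ i) b *+ b`!.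
Proof.
move=> hd; rewrite /last_color lsum_cat.
pose chi i v : R := (uniq v && all [predC [set k; i]] v)%:R * \prod_(c <- v) x c.
transitivity (lsum b (fun v => \sum_(i in [set~ k])
    chi i v * (x k * lsum s (fun w => weight (i :: w))))).
  apply: eq_lsum => v sv; rewrite lsumS [RHS]big_mkcond; apply: eq_bigr => i _.
  transitivity (lsum s (fun w => ((uniq (k :: v) && (i \notin k :: v))%:R *
     \prod_(c <- k :: v) x c) * weight (i :: w))).
    apply: eq_lsum => w sw; rewrite -cat_cons (weight_clique _ sw) //.
    by move=> t; rewrite /= sv => ht; apply: hd; lia.
  rewrite lsumMl !inE big_cons /chi.
  have -> : all [predC [set k; i]] v = (k \notin v) && (i \notin v).
    elim: (v) => [//|c u IHu] /=; rewrite IHu !inE !negb_or ![_ == c]eq_sym.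
    by rewrite -!andbA; congr (_ && _); rewrite andbCA.
  (* The two end vertices are adjacent, which kills the term [i = k]. *)
  case: (i == k); rewrite ?andbF ?mul0r //=.
  by case: (k \in v) (i \in v) (uniq v) => [] [] [] /=; ring.
rewrite lsum_sum mulr_sumr; apply: eq_bigr => i _.
rewrite lsumMr lsum_uniq.
have -> : ~: [set k; i] = [set~ k] :\ i.
  by apply/setP => c; rewrite !inE negb_or andbC.
by rewrite mulrnAl mulrnAr mulrC -mulrA.
Qed.

End ListSums.

(** If vertex [j] has no earlier neighbor, it multiplies the total for the previous vertices by x_k.
    Otherwise it closes a clique that starts at [j - d j] and is glued to the graph ending there. *)
Lemma last_color_positive (n : nat) (d : nat -> nat) :
  (forall j, j < n -> d j <= j)%N ->
  (forall j t, j < n -> j - d j < t <= j -> d t = t - (j - d j))%N ->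
  forall j, (j < n)%N -> vpositive (fun R C x k => last_color x d j k).
Proof.
move=> dle dclique; elim/ltn_ind => j IH jn.
case: (posnP (d j)) => dj.
  apply: (@vpositive_ext _ (fun R C x k => x k * lsum j (weight x d))).
    by move=> R C x k; apply: last_color_isolated.
  apply: vpositive_start; case: j IH jn {dj} => [|j] IH jn.
    by exists [:: [::]] => R C x; rewrite big_seq1 big_nil.
  exact: (vpositive_total (IH _ (ltnSn j) (ltnW jn))).
have le_dj := dle _ jn.
(* [b] counts the vertices strictly between [s] and [j]. *)
pose s := (j - d j)%N; pose b := (d j).-1.
have sj : (s < j)%N by rewrite /s; lia.
have jE : (j = b + s.+1)%N by rewrite /s /b; lia.
have h := vpositiveMn b`! (vpositive_glue b (IH _ sj (ltn_trans sj jn))).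
apply: vpositive_ext h => R C x k.
rewrite jE last_color_clique ?mulr_sumr ?mulrnAr -?sumrMnl.
  by apply: eq_bigr => i _; rewrite mulrnAr.
by move=> t ht; apply: dclique => //; rewrite -/s; lia.
Qed.

Lemma lsum_weight_positive (n : nat) (d : nat -> nat) :
  (forall j, j < n -> d j <= j)%N ->
  (forall j t, j < n -> j - d j < t <= j -> d t = t - (j - d j))%N ->
  epositive (fun R C x => lsum n (weight x d)).
Proof.
case: n => [|n] dle dc; first by exists [:: [::]] => R C x; rewrite big_seq1 big_nil.
exact: (vpositive_total (last_color_positive dle dc (ltnSn n))).
Qed.

(** * From polynomials to power series *)

Module Truncation.
Import mpoly.
Local Notation agree N := (@EExpansion.agree N).
Section Truncation.
Variable N : nat.

Local Notation X := (fun i : 'I_N => mpolyX int (mnm1 i) : mpoly N int).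

Lemma esum_mesym k : esum X k = mesym N int k.
Proof. by apply: eq_bigl => B; rewrite subsetT. Qed.

Lemma emb_ucm (i : 'I_N) : EExpansion.emb (mnm1 i) = ucm (i : nat).
Proof.
apply/eqP/cmP => j; rewrite ucmE; case: (ltnP j N) => h.
  by rewrite -[j]/(val (Ordinal h)) EExpansion.embO mnm1E.
rewrite EExpansion.embN //; case: eqP => // ij.
by move: h; rewrite -ij leqNgt ltn_ord.
Qed.

Lemma emb_prod (V : finType) (k : V -> 'I_N) :
  EExpansion.emb (\big[@mnm_add N/mnm0]_(v : V) mnm1 (k v)) =
  \big[mmul/mone]_(v : V) ucm (k v : nat).
Proof.
rewrite (big_morph _ (@EExpansion.emb_add N) (_ : _ = mone)).
  by apply: eq_bigr => v _; rewrite emb_ucm.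
by apply/eqP; rewrite -monalg.mdeg_eq0 EExpansion.emb_deg mdeg0.
Qed.

(** A monomial in the first [N] variables arises only from colorings with values below [N], and
    these are the images under [up]. *)
Lemma agree_chromatic (V : finType) (e : rel V) :
  agree N (chromatic_symf e)
    (\sum_(k : {ffun V -> 'I_N} | [forall u, forall v, e u v ==> (k u != k v)])
       \prod_v X (k v)).
Proof.
move=> m; rewrite raddf_sum /chromatic_symf.
pose up (k : {ffun V -> 'I_N}) : {ffun V -> nat} := [ffun v => val (k v)].
have up_inj : injective up.
  by move=> k l /ffunP h; apply/ffunP => v; have := h v; rewrite !ffunE => /val_inj.
pose P (k : {ffun V -> 'I_N}) := [forall u, forall v, e u v ==> (k u != k v)].
have upP k : P k <-> proper_coloring e (up k).
  split=> [h u v uv|h]; first by rewrite !ffunE; apply: (implyP (forallP (forallP h u) v)).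
  apply/forallP => u; apply/forallP => v; apply/implyP => /h.
  by rewrite !ffunE.
have up_prop k : k \in [seq up l | l <- enum P] -> proper_coloring e k.
  by case/mapP => l; rewrite mem_enum => /upP h ->.
rewrite (fsbigE [seq up k | k <- enum P]).
- rewrite big_seq_cond (eq_bigl (fun k => k \in [seq up l | l <- enum P])); last first.
    move=> k; case: (boolP (k \in [seq up l | l <- enum P])) => //= hk.
    by apply/mem_set/up_prop.
  rewrite -big_seq big_map big_enum /=; apply: eq_bigr => k _.
  rewrite mprodXE mcoeffX -(inj_eq (@EExpansion.emb_inj N)) eq_sym emb_prod.
  by congr ((_ == _)%:R); apply: eq_bigr => v _; rewrite ffunE.
- by rewrite map_inj_uniq ?enum_uniq.
- exact: up_prop.
move=> k kP; case: eqP => // mk; case/negP.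
have kN v : (k v < N)%N.
  rewrite ltnNge; apply/negP => Nk.
  have := EExpansion.embN m Nk; rewrite mk.
  rewrite (big_morph (fun a : {cmonom nat} => a (k v)) (cmM (k v)) (cm1 (k v))).
  by rewrite (bigD1 v) //= ucmE eqxx.
have kE : k = up [ffun v => Ordinal (kN v)].
  by apply/ffunP => v; rewrite !ffunE.
apply/mapP; exists [ffun v => Ordinal (kN v)] => //.
by rewrite mem_enum; apply/upP; rewrite -kE.
Qed.

End Truncation.

(** A monomial involves finitely many variables, so its coefficient is visible in a large enough
    truncation. *)
Lemma pseries_agree (f g : pseries) :
  (forall N, exists2 p, agree N f p & agree N g p) -> f = g.
Proof.
move=> h; apply: funext => m.
pose N := (\max_(i <- finsupp m) i).+1.
have [p fp gp] := h N.
have -> : m = EExpansion.emb (EExpansion.res N m).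
  apply/eqP/cmP => i; case: (ltnP i N) => iN.
    by rewrite -[i]/(val (Ordinal iN)) EExpansion.embO mnmE.
  rewrite EExpansion.embN //; apply/eqP; rewrite cmE_eq0.
  apply: contraL iN => im; rewrite -ltnNge ltnS.
  exact: (@leq_bigmax_seq _ (enum_fset (finsupp m)) xpredT id i im).
by rewrite fp gp.
Qed.

Lemma sort_parts_subproof (l : seq nat) :
  sorted geq (sort geq [seq j <- l | j != 0]%N) &&
  (0%N \notin sort geq [seq j <- l | j != 0]%N).
Proof.
by rewrite sort_sorted ?mem_sort ?mem_filter // => i j; apply: leq_total.
Qed.

(** Reordering and dropping zeros leave the product of the e_j unchanged, as e_0 = 1. *)
Definition sort_parts l : intpart := IntPart (sort_parts_subproof l).

Lemma agree_sort_parts N l :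
  agree N (partprod esymf (sort_parts l))
    (\prod_(j <- l) esum (fun i : 'I_N => mpolyX int (mnm1 i) : mpoly N int) j).
Proof.
have -> : \prod_(j <- l) esum (fun i : 'I_N => mpolyX int (mnm1 i) : mpoly N int) j =
    \prod_(j <- sort_parts l) mesym N int j.
  rewrite [RHS](perm_big _ (permEl (perm_sort geq _))) big_filter [RHS]big_mkcond /=.
  apply: eq_bigr => j _; rewrite esum_mesym.
  by case: eqP => // ->; rewrite mesym0E.
rewrite /partprod; elim: (parts _) => [|j s IH].
  by rewrite !big_nil; apply: EExpansion.agree1.
by rewrite !big_cons; apply: EExpansion.agreeM => //; apply: EExpansion.agree_esymf.
Qed.

(** The coefficients are multiplicities, hence nonnegative. *)
Definition count_fsfun (s : seq intpart) : {fsfun intpart -> int with 0} :=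
  [fsfun la in seq_fset tt s => (count_mem la s)%:R | 0].

Lemma count_fsfunE s la : count_fsfun s la = (count_mem la s)%:R.
Proof.
rewrite fsfun_fun seq_fsetE; case: ifPn => // /count_memPn ->; by [].
Qed.

Lemma lincomb_count b s : lincomb b (count_fsfun s) = fun m => \sum_(la <- s) b la m.
Proof.
apply: funext => m; rewrite -big_undup_iterop_count /lincomb.
rewrite (perm_big (undup s)) /=.
  by apply: eq_bigr => la _; rewrite count_fsfunE mulr_natl.
apply: uniq_perm; rewrite ?fset_uniq ?undup_uniq // => la.
rewrite mem_finsupp count_fsfunE mem_undup -has_pred1 has_count pnatr_eq0.
by rewrite lt0n.
Qed.

(** The expansion of [G] does not depend on [N], so the truncated identities lift to one e-expansion
    of [f], whose coefficients [omega] keeps. *)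
Lemma epositive_omega (f : pseries) (G : color_sum) :
  epositive G ->
  (forall N, agree N f (G _ _ (fun i : 'I_N => mpolyX int (mnm1 i) : mpoly N int))) ->
  h_positive (omega f).
Proof.
move=> [L hL] fG.
have -> : f = lincomb (partprod esymf) (count_fsfun [seq sort_parts l | l <- L]).
  apply: pseries_agree => N; eexists; first exact: fG.
  rewrite hL lincomb_count => m; rewrite big_map.
  rewrite raddf_sum; apply: eq_bigr => l _.
  exact: (agree_sort_parts l m).
rewrite omega_lincomb; eexists; first by [].
by move=> la; rewrite count_fsfunE ler0n.
Qed.

End Truncation.

(** * Proper colorings of a graph as proper lists *)

Section ColoringLists.
Variables (R : comNzRingType) (C : finType) (x : C -> R) (d : nat -> nat).

Fixpoint proper_list (w : seq C) : bool :=
  if w is k :: w' then (k \notin take (d (size w')) w') && proper_list w' else true.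

Lemma weightE w : weight x d w = (proper_list w)%:R * \prod_(c <- w) x c.
Proof.
elim: w => [|k w IH] /=; first by rewrite big_nil mul1r.
by rewrite IH big_cons; case: (k \in _); rewrite ?mul0r // !mul1r mulrCA.
Qed.

(** Lists run from the last vertex down, so vertex [i] has its color at position [i] of [rev w]. *)
Lemma proper_listP (c : C) w :
  proper_list w <->
  forall i j, (i < j < size w)%N -> (j <= i + d j)%N ->
    nth c (rev w) i != nth c (rev w) j.
Proof.
elim: w => [|k w IH] /=; first by split => // _ i j /andP[].
have nthE i : (i < size w)%N -> nth c (rev (k :: w)) i = nth c (rev w) i.
  by move=> h; rewrite rev_cons nth_rcons size_rev h.
have nthk : nth c (rev (k :: w)) (size w) = k.
  by rewrite rev_cons nth_rcons size_rev ltnn eqxx.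
have nth_w i : (i < size w)%N -> nth c (rev w) i = nth c w (size w - i.+1).
  exact: nth_rev.
split.
  case/andP => kw /IH h i j /andP[ij]; rewrite ltnS leq_eqVlt.
  case/orP => [/eqP jE|jw] ji; last first.
    by rewrite !nthE ?(ltn_trans ij) //; apply: h => //; rewrite ij.
  move: ij ji; rewrite {}jE => iw wi.
  rewrite nthk nthE // nth_w //; apply: contraNneq kw => <-.
  have hp : (size w - i.+1 < d (size w))%N by lia.
  rewrite -(nth_take c hp); apply: mem_nth; rewrite size_take_min leq_min hp.
  by rewrite ltn_subrL (leq_ltn_trans _ iw).
move=> h; apply/andP; split; last first.
  apply/IH => i j /andP[ij jw] ji; rewrite -!nthE ?(ltn_trans ij) //.
  by apply: h => //; rewrite ij ltnS ltnW.
(* Position [p] of [w] belongs to vertex [size w - p.+1]. *)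
apply/negP => /(nthP c)[p]; rewrite size_take_min leq_min => /andP[pd pw].
rewrite nth_take // => pk.
have hp : (size w - p.+1 < size w < (size w).+1)%N.
  by rewrite ltnS leqnn andbT ltn_subrL (leq_ltn_trans _ pw).
have dp : (size w <= size w - p.+1 + d (size w))%N.
  by rewrite -leq_subLR subKn.
have /eqP[] := h _ _ hp dp.
have /andP[lt_pw _] := hp.
by rewrite nthk nthE // nth_w // subnSK // subKn ?pk // ltnW.
Qed.

Lemma sum_proper_coloring n (e : rel 'I_n) :
  (forall i j : 'I_n, (i < j)%N -> e i j = (j <= i + d j)%N) ->
  symmetric e -> irreflexive e ->
  \sum_(k : {ffun 'I_n -> C} | [forall u, forall v, e u v ==> (k u != k v)])
     \prod_v x (k v) = lsum n (weight x d).
Proof.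
move=> ed esym eirr; rewrite lsum_tuple big_mkcond /=.
pose h (t : n.-tuple C) : {ffun 'I_n -> C} := [ffun i => tnth t (rev_ord i)].
rewrite (reindex h) /=; last first.
  exists (fun k : {ffun 'I_n -> C} => [tuple k (rev_ord i) | i < n]) => [t _|k _].
    by apply: eq_from_tnth => i; rewrite tnth_mktuple ffunE rev_ordK.
  by apply/ffunP => i; rewrite ffunE tnth_mktuple rev_ordK.
apply: eq_bigr => t _; rewrite weightE.
have hE c (i : 'I_n) : nth c (rev t) i = h t i.
  rewrite nth_rev ?size_tuple // ffunE (tnth_nth c); by [].
have -> : [forall u, forall v, e u v ==> (h t u != h t v)] = proper_list t.
  apply/idP/idP => [p|].
    case: n => [|n] in e ed esym eirr t h hE p *; first by rewrite tuple0.
    apply/(proper_listP (tnth t ord0)) => i j; rewrite size_tuple => /andP[ij jn] ji.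
    have := implyP (forallP (forallP p (Ordinal (ltn_trans ij jn))) (Ordinal jn)).
    by rewrite ed // -!(hE (tnth t ord0)); apply.
  move=> p; apply/forallP => u; apply/forallP => v; apply/implyP => uv.
  have {}p c := (proper_listP c t).1 p.
  wlog lt_uv : u v uv / (u < v)%N => [wl|].
    case: (ltngtP u v) => [||/val_inj uvE]; first exact: wl.
      by rewrite eq_sym => vu; apply: wl; rewrite // esym.
    by move: uv; rewrite uvE eirr.
  rewrite -[h t v](hE (h t u)) -[h t u in X in X != _](hE (h t u)); apply: p; rewrite ?size_tuple ?lt_uv ?ltn_ord //.
  by rewrite -ed.
case: (proper_list t); rewrite ?mul0r ?mul1r // (big_tuple _ _ t).
rewrite (reindex_inj rev_ord_inj) /=; apply: eq_bigr => i _.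
by rewrite ffunE rev_ordK.
Qed.

End ColoringLists.

(** * Unit interval orders avoiding 2+1+1 *)

Section UnitIntervalOrder.
Variables (n : nat) (prec : rel 'I_n).
Hypothesis nuio : natural_unit_interval_order prec.
Local Notation inc := (incomparable prec).

Lemma incC : symmetric inc.
Proof. by move=> a b; rewrite /incomparable eq_sym [~~ prec a b && _]andbC. Qed.

Lemma inc_irr : irreflexive inc.
Proof. by move=> a; rewrite /incomparable eqxx. Qed.

Lemma incNprec (a b : 'I_n) : (a < b)%N -> inc a b = ~~ prec a b.
Proof.
move=> ab; rewrite /incomparable; have -> : a != b by apply: contraTneq ab => ->; rewrite ltnn.
have -> : prec b a = false.
  by apply/negP => /(nuio_linext nuio); rewrite ltnNge ltnW.
by rewrite andbT.
Qed.

(** If [prec k j], transitivity forbids [prec i k]; then [i] is incomparable to both [k] and [j] and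
    has to lie between them, against [i < k]. *)
Lemma inc_suffix (i k j : 'I_n) : (i < k)%N -> (k < j)%N -> inc i j -> inc k j.
Proof.
move=> ik kj ij; rewrite incNprec //; apply/negP => pkj.
suff ik' : inc i k by have := nuio_between nuio pkj ik' ij; rewrite ltnNge (ltnW ik).
rewrite incNprec //; apply/negP => pik; move: ij.
by rewrite incNprec ?(ltn_trans ik) // (nuio_trans nuio pik pkj).
Qed.

Lemma inc_prefix (i k j : 'I_n) : (i < k)%N -> (k < j)%N -> inc i j -> inc i k.
Proof.
move=> ik kj ij; rewrite incNprec //; apply/negP => pik.
suff jk : inc j k.
  by have := nuio_between nuio pik (etrans (incC _ _) ij) jk; rewrite [(j < k)%N]ltnNge (ltnW kj) andbF.
rewrite incC incNprec //; apply/negP => pkj; move: ij.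
by rewrite incNprec ?(ltn_trans ik) // (nuio_trans nuio pik pkj).
Qed.

(** Otherwise [prec r j], and this chain together with the incomparable pair [s], [t] is a 2+1+1. *)
Lemma inc_diamond (r s t j : 'I_n) : avoids_2_1_1 prec ->
  (r < s)%N -> (s < t)%N -> (t < j)%N -> inc r t -> inc s j -> inc r j.
Proof.
move=> av rs st tj rt sj; rewrite incNprec; last by lia.
apply/negP => rj; case: av; exists r, j, s, t.
have st' := inc_prefix st tj sj; have tj' := inc_suffix st tj sj.
have rs' := inc_prefix rs st rt.
split=> //; last 2 first.
- by rewrite incC rs'.
- by rewrite incC rt.
rewrite /= !inE -!val_eqE /=; lia.
Qed.

Lemma left_degreeP : avoids_2_1_1 prec -> exists d : nat -> nat,
  [/\ forall j, (j < n -> d j <= j)%N,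
      forall j t, (j < n -> j - d j < t <= j -> d t = t - (j - d j))%N
    & forall i j : 'I_n, (i < j)%N -> inc i j = (j <= i + d j)%N].
Proof.
(* [inord] needs a nonempty ordinal type, so the empty order is treated apart. *)
move=> av; case: n prec nuio av inc_suffix inc_prefix inc_diamond => [|m] P _ av suf pre dia.
  by exists id; split=> [||[]].
pose adj i j := incomparable P (inord i : 'I_m.+1) (inord j).
(* The least neighbor of [j] below [j], or [j] itself if there is none. *)
pose l j := find (adj^~ j) (iota 0 j).
have lj j : (l j <= j)%N by rewrite -[X in (_ <= X)%N](size_iota 0) find_size.
have before i j : (i < l j)%N -> adj i j = false.
  move=> h; have := before_find 0 h; rewrite nth_iota //.
  exact: leq_trans h (lj j).
have at_l j : (l j < j)%N -> adj (l j) j.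
  move=> h; have := @nth_find _ 0 (adj^~ j) (iota 0 j).
  by rewrite has_find size_iota nth_iota ?add0n //; apply.
have adjE i j : (i < j < m.+1)%N -> adj i j = (l j <= i)%N.
  case/andP=> ij jm; case: (ltngtP (l j) i) => [li||li]; last first.
  - by have := at_l j; rewrite li; apply.
  - exact: before.
  have := at_l j (ltn_trans li ij); apply: suf; rewrite !inordK //; lia.
exists (fun j => j - l j)%N; split => [j _|j t jm|i j ij]; first exact: leq_subr.
  rewrite subKn // => /andP[lt tj]; suff -> : l t = l j by [].
  move: tj; rewrite leq_eqVlt => /orP[/eqP -> //|tj].
  have ljj := at_l j (ltn_trans lt tj).
  have adjt : adj (l j) t by move: ljj; apply: pre; rewrite !inordK //; lia.
  have le_tj : (l t <= l j)%N by rewrite -adjE // lt /=; lia.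
  (* If [l t < l j < t < j], then [inc_diamond] makes [l t] a neighbor of [j], against the
     minimality of [l j]. *)
  apply/eqP; rewrite eqn_leq le_tj /= leqNgt; apply/negP => lt_tj.
  have := before _ _ lt_tj => /negP; apply.
  have lt_t : (l t < t)%N by lia.
  apply: (dia _ (inord (l j)) (inord t) _ av); rewrite ?inordK //; try lia.
  exact: at_l.
have := adjE i j; rewrite /adj !inord_val ij ltn_ord => -> //.
by have := lj j; lia.
Qed.

End UnitIntervalOrder.

Theorem theorem4p1 (n : nat) (prec : rel 'I_n) :
  (0 < n)%N ->
  natural_unit_interval_order prec ->
  avoids_2_1_1 prec ->
  h_positive (omega (chromatic_symf (incomparable prec))).
Proof.
move=> _ nuio av; have [d [dle dclique dE]] := left_degreeP nuio av.
apply: (Truncation.epositive_omega (lsum_weight_positive dle dclique)) => N.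
rewrite -(sum_proper_coloring _ dE (@incC _ prec) (@inc_irr _ prec)).
exact: Truncation.agree_chromatic.
Qed.
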